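(* Let $C_m$ be a Hermitian code with $q^2-q-1\le m\le 2q^2-2q-3$ and $m=\widetilde m$. If $D$ is an $\mathbb{F}_{q^2}$-divisor of degree $\delta(m)=\widetilde\delta_m=\mu q+\lambda(q+1)$ (with $0\le\mu\le q$, $\lambda\ge0$), then $D\in\mathcal{M}_m$ if and only if $D=\mathcal{H}\cap\mathcal{X}$ with $\mathcal{X}$ a curve defined by a polynomial $F$ such that $\mathrm{LM}_\prec(F)=x^\mu y^\lambda$.
   Context: $q$ is a power of a prime, $A=\mathbb{F}_{q^2}[x,y]$, and $\mathcal{H}$ is the affine Hermitian curve defined by $H=x^{q+1}-y^q-y$. It has exactly $n=q^3$ points $P_1,\dots,P_n$ with coordinates in $\mathbb{F}_{q^2}$; $E=\{P_1,\dots,P_n\}$ and $A_E=A/\langle H,x^{q^2}-x,y^{q^2}-y\rangle$. An $\mathbb{F}_{q^2}$-divisor is a subset $D\subseteq E$ (a sum of pairwise distinct $\mathbb{F}_{q^2}$-points of $\mathcal{H}$); its degree is its cardinality $|D|$, and $I_D\subseteq A$ is the ideal of polynomials vanishing on $D$. Weights: $w(x^ry^s)=rq+s(q+1)$. $V_m\subseteq A_E$ is the span of the classes of monomials of weight $w\le m$, and the Hermitian code $C_m\subseteq(\mathbb{F}_{q^2})^n$ is the dual code of $\{(f(P_1),\dots,f(P_n)) : f\in V_m\}$. The support of a codeword $(c_1,\dots,c_n)$ is identified with the set of points $\{P_i: c_i\neq0\}\subseteq E$, and $\mathcal{M}_m$ is the set of supports of minimum-weight (nonzero) codewords of $C_m$.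 $\mathcal{B}=\{x^ry^s : 0\le r\le q,\ 0\le s\le q^2-q-1\}\cup\{y^s : q^2-q\le s\le q^2-1\}$, and $\Lambda_{\mathcal{B}}=\{w(x^ry^s): x^ry^s\in\mathcal{B}\}$. $\Lambda$ is the numerical semigroup generated by $q$ and $q+1$; each element is written uniquely as $aq+b(q+1)$ with integers $0\le a\le q$, $b\ge0$. Put $\delta(m)=m-q^2+q+2$. $\widetilde m$ denotes the minimum integer $m'\ge m$ such that both $m'+1\in\Lambda_{\mathcal{B}}$ and $\delta(m')\in\Lambda$; and $\widetilde\delta_m=\delta(\widetilde m)$. $\prec$ is the degree reverse lexicographic order with $y>x$: $x^{r_1}y^{r_2}\prec x^{s_1}y^{s_2}$ iff $r_1+r_2<s_1+s_2$, or $r_1+r_2=s_1+s_2$ and $r_1>s_1$. $\mathrm{LM}_\prec(F)$ is the $\prec$-largest monomial occurring in $F\in A$. $D=\mathcal{H}\cap\mathcal{X}$ means scheme-theoretic intersection in the affine plane, i.e. $I_D=\langle H,F\rangle$. *)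

(* Defs.v *)
From mathcomp Require Import all_boot all_order all_algebra.
From mathcomp Require Import mpoly.

Set Implicit Arguments.
Unset Strict Implicit.
Unset Printing Implicit Defensive.

Import Order.TTheory GRing.Theory Num.Theory.
Local Open Scope ring_scope.

Notation ix := (ord0 : 'I_2).
Notation iy := (ord_max : 'I_2).

Definition ideal_gen (R : comNzRingType) (s : seq R) (f : R) : Prop :=
  exists c : nat -> R, f = \sum_(i < size s) c i * s`_i.

Section Monomials.

Variable q : nat.

Definition weight (u : 'X_{1..2}) : nat := (u ix * q + u iy * q.+1)%N.

(* The truncated subtractions are exact for q >= 2. *)
Definition inB (u : 'X_{1..2}) : bool :=
  ((u ix <= q) && (u iy <= q ^ 2 - q - 1)
   || [&& u ix == 0, q ^ 2 - q <= u iy & u iy <= q ^ 2 - 1])%N.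

Definition LambdaB (z : int) : Prop :=
  exists2 u : 'X_{1..2}, inB u & z = (weight u)%:Z.

Definition Lambda (z : int) : Prop :=
  exists a b : nat, z = (a * q + b * q.+1)%N%:Z.

Definition delta (m : int) : int := m - q%:Z ^+ 2 + q%:Z + 2.

(* is_tilde m mt: mt is the least mt >= m with mt + 1 \in LambdaB and
   delta mt \in Lambda. *)
Definition is_tilde (m mt : int) : Prop :=
  [/\ m <= mt, LambdaB (mt + 1), Lambda (delta mt) &
      forall m' : int, m <= m' -> LambdaB (m' + 1) -> Lambda (delta m') ->
        mt <= m'].

End Monomials.

(* degree reverse lexicographic order with y > x *)
Definition prec (u v : 'X_{1..2}) : bool :=
  ((u ix + u iy < v ix + v iy)
   || (u ix + u iy == v ix + v iy) && (v ix < u ix))%N.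

Definition is_LM (R : nzRingType) (F : {mpoly R[2]}) (u : 'X_{1..2}) : Prop :=
  u \in msupp F /\ forall v, v \in msupp F -> v != u -> prec v u.

Section Hermitian.

Variables (K : finFieldType) (q : nat).

Local Notation A := {mpoly K[2]}.
Local Notation point := {ffun 'I_2 -> K}.

Definition hermH : A := 'X_ix ^+ q.+1 - 'X_iy ^+ q - 'X_iy.

Definition hermE : {set point} := [set P : point | hermH.@[P] == 0].

Definition vanishing_ideal (D : {set point}) (f : A) : Prop :=
  forall P, P \in D -> f.@[P] = 0.

Definition ideal_E : A -> Prop :=
  ideal_gen [:: hermH; 'X_ix ^+ (q ^ 2) - 'X_ix; 'X_iy ^+ (q ^ 2) - 'X_iy].

(* V_m is a subspace of the quotient A_E of A by ideal_E; it is represented by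
   its preimage in A.  Since ideal_E vanishes on E, evaluation at the points of
   E does not depend on the representative. *)
Definition Vm (m : int) (f : A) : Prop :=
  exists2 g : A, (forall u, u \in msupp g -> (weight q u)%:Z <= m)
               & ideal_E (f - g).

Definition word := 'rV[K]_#|hermE|.

Definition pt (i : 'I_#|hermE|) : point := enum_val i.

Definition eval_word (f : A) : word := \row_i f.@[pt i].

Definition dual_code (S : word -> Prop) (c : word) : Prop :=
  forall v, S v -> \sum_i c 0 i * v 0 i = 0.

Definition hermitian_code (m : int) : word -> Prop :=
  dual_code (fun v => exists2 f, Vm m f & v = eval_word f).

Definition supp (c : word) : {set point} :=
  [set pt i | i : 'I_#|hermE| & c 0 i != 0].

Definition hweight (c : word) : nat := #|[set i | c 0 i != 0]|.

Definition min_weight_word (S : word -> Prop) (c : word) : Prop :=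
  [/\ S c, c != 0 & forall c', S c' -> c' != 0 -> (hweight c <= hweight c')%N].

Definition min_supports (m : int) (D : {set point}) : Prop :=
  exists2 c, min_weight_word (hermitian_code m) c & D = supp c.

(* equality of ideals I_D = <H, F> *)
Definition scheme_intersection (D : {set point}) (F : A) : Prop :=
  forall f : A, vanishing_ideal D f <-> ideal_gen [:: hermH; F] f.

End Hermitian.

(* Main.v *)
Require Import Defs.
From mathcomp Require Import all_boot all_order all_algebra.
From mathcomp Require Import mpoly.
From mathcomp Require Import zify ring finfield.

Set Implicit Arguments.
Unset Strict Implicit.
Unset Printing Implicit Defensive.

Import Order.TTheory GRing.Theory Num.Theory.

(** A codeword of the Hermitian code is a linear relation among the
    evaluations, at the points of its support [D], of the polynomials of weight
    at most [m].  So [D] contains the support of a nonzero codeword exactly when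
    these polynomials do not realize every function on [D].

    Filter the functions on [D] by weight.  On the curve [y ^ q] can be traded
    for [x ^ q.+1] up to lower weight, hence all monomials of one weight agree
    modulo lower weight and the dimension grows by at most one at each weight;
    call the weights where it grows the jumps of [D].  All functions on [D] are
    polynomial, so there are [#|D|] jumps.  If [s] is the weight of a monomial
    but not a jump, some polynomial of weight [s] vanishes on [D]; multiplying
    it by monomials shows that no [s + t] with [t] in the semigroup of weights
    is a jump ([jump_divisor]).

    Lower bound on the distance.  If weights up to [m] do not suffice there is a
    jump [s > m], and then every [t] with [t] and [s - t] in the semigroup is a
    jump.  The semigroup has [(q * q - q) / 2] gaps, so there are at least
    [s + 1 - (q * q - q)] such [t], and [#|D| >= delta m]
    ([designed_distance]).

    A minimum-weight support is cut out by one curve.  If equality holds then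
    [s = m + 1] and the jumps are exactly these [t].  Now [m + 1 - #|D|] is
    [q * q - q - 1], the largest gap, so [#|D|] is not a jump
    ([card_not_jump]): some [F] vanishing on [D] has leading weight [#|D|], the
    weight of the prescribed monomial.  The jumps avoid [#|D| + semigroup], so
    they lie in the Apery set of [#|D|]; that set has at most [#|D|] elements,
    hence the jumps fill it ([jump_apery]).  The leading weight of a polynomial
    vanishing on [D] is not a jump, so it lies in [#|D| + semigroup], and
    division by [F] and the curve equation leaves remainder zero
    ([vanishing_in_ideal]).

    Such a curve gives a minimum-weight support.  If [F] with that leading
    monomial vanishes on [D], then [#|D|] is not a jump, and again the jumps are
    the Apery set of [#|D|].  It contains [m + 1], because [m + 1 - #|D|] is a
    gap, so the weights up to [m] do not suffice and there is a nonzero codeword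
    supported in [D] ([word_of_filtration]).  By the lower bound its support is
    all of [D] and its weight is minimal.

    In the range of [m] considered the monomials involved have degree less than
    [q], where the order by weight and the degree order agree ([prec_weight],
    [weight_prec]). *)

(** * The numerical semigroup generated by q and q + 1 *)

Section Semigroup.

Variable q : nat.
Hypothesis q_gt1 : (1 < q)%N.

(** Since [a * q + b * q.+1 = (a + b) * q + b], the least possible [b] in a
    decomposition of [s] is [s %% q], and then [a = s %/ q - s %% q] has to be
    nonnegative. *)
Definition in_semigroup (s : nat) : bool := (s %% q <= s %/ q)%N.

Lemma in_semigroup_divn (k r : nat) :
  (r < q)%N -> in_semigroup (k * q + r) = (r <= k)%N.
Proof.
move=> rq; rewrite /in_semigroup modnMDl divnMDl; last lia.
by rewrite modn_small // divn_small // addn0.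
Qed.

Lemma in_semigroup_gen (a b : nat) : in_semigroup (a * q + b * q.+1).
Proof.
have -> : (a * q + b * q.+1 = (a + b + b %/ q) * q + b %% q)%N.
  by rewrite mulnS !mulnDl; have := divn_eq b q; lia.
have r_lt : (b %% q < q)%N by rewrite ltn_pmod // ltnW.
by rewrite in_semigroup_divn // (leq_trans (leq_mod b q)) // addnAC leq_addl.
Qed.

Lemma in_semigroupE (s : nat) : in_semigroup s ->
  s = ((s %/ q - s %% q) * q + s %% q * q.+1)%N.
Proof. by rewrite /in_semigroup {3}(divn_eq s q); nia. Qed.

Lemma in_semigroupD (s t : nat) :
  in_semigroup s -> in_semigroup t -> in_semigroup (s + t).
Proof.
move=> /in_semigroupE-> /in_semigroupE->.
by rewrite addnACA -!mulnDl in_semigroup_gen.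
Qed.

Lemma in_semigroup_large (s : nat) : (q * q - q <= s)%N -> in_semigroup s.
Proof.
rewrite /in_semigroup => hs; have := divn_eq s q; have := @ltn_pmod s q.
by nia.
Qed.

(** The gaps of the semigroup are symmetric about (q * q - q - 1) / 2: writing
    [s = k * q + r], the reflection replaces [k] by [q - 2 - k] and [r] by
    [q - 1 - r], which reverses the inequality [r <= k]. *)
Lemma in_semigroup_sym (s : nat) : (s < q * q - q)%N ->
  in_semigroup (q * q - q - s.+1) = ~~ in_semigroup s.
Proof.
move: (s %/ q) (s %% q) (ltn_pmod s (ltnW q_gt1)) (divn_eq s q) => k r r_lt ->.
move=> hs; have k_le : (k + 2 <= q)%N by nia.
have -> : (q * q - q - (k * q + r).+1 = (q - 2 - k) * q + (q - 1 - r))%N by nia.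
by rewrite !in_semigroup_divn; lia.
Qed.

Lemma largest_gap : in_semigroup (q * q - q - 1) = false.
Proof.
rewrite in_semigroup_sym; last by nia.
by rewrite /in_semigroup mod0n div0n.
Qed.

Definition gaps_below (n : nat) : nat := \sum_(s < n) ~~ in_semigroup s.

(** The reflection [in_semigroup_sym] exchanges gaps and non-gaps below
    [q * q - q], so exactly half of these numbers are gaps; there are no gaps
    beyond. *)
Lemma gaps_below_bound (n : nat) : (2 * gaps_below n <= q * q - q)%N.
Proof.
set g2 := (q * q - q)%N.
have gaps_monotone : (gaps_below n <= gaps_below g2)%N.
  rewrite /gaps_below; case: (leqP n g2) => [le_n | /ltnW le_g2].
    rewrite -!(big_mkord xpredT (fun s => nat_of_bool (~~ in_semigroup s))).
    by rewrite [leqRHS](big_cat_nat (leq0n n) le_n) leq_addr.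
  rewrite -!(big_mkord xpredT (fun s => nat_of_bool (~~ in_semigroup s))).
  rewrite (big_cat_nat (leq0n g2) le_g2) /= -[leqRHS]addn0 leq_add2l.
  rewrite big_nat_cond big1 // => s /andP[/andP[hs _] _].
  by rewrite in_semigroup_large.
suff: (gaps_below g2 + gaps_below g2 = g2)%N by lia.
rewrite {2}/gaps_below (reindex_inj rev_ord_inj) /= -big_split /=.
rewrite -[RHS]card_ord -sum1_card; apply: eq_bigr => s _.
by rewrite in_semigroup_sym ?ltn_ord //; case: in_semigroup.
Qed.

(** At most [q * q - q] of the [n.+1] values [s <= n] fail, since either [s] or
    [n - s] is then a gap. *)
Lemma count_decompositions (n : nat) :
  (n.+1 <= count (fun s => in_semigroup s && in_semigroup (n - s))
                 (iota 0 n.+1) + (q * q - q))%N.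
Proof.
have := gaps_below_bound n.+1; set c := count _ _.
suff: (n.+1 <= c + 2 * gaps_below n.+1)%N by lia.
have gaps_rev : gaps_below n.+1 = \sum_(s < n.+1) ~~ in_semigroup (n - s).
  rewrite /gaps_below (reindex_inj rev_ord_inj).
  by apply: eq_bigr => s _; rewrite /= subSS.
rewrite mul2n -addnn {2}gaps_rev.
rewrite /c {c} -sum1_count big_mkcond -[iota _ _]/(index_iota 0 n.+1) big_mkord.
rewrite -!big_split /= -{1}[n.+1]card_ord -sum1_card; apply: leq_sum => s _.
by do 2![case: in_semigroup].
Qed.

(** Two elements of the semigroup that are congruent modulo [d] differ by a
    multiple of [d], so the larger one lies in [d + semigroup]: an Apery set
    has at most one element in each residue class. *)
Lemma count_apery (d : nat) (T : pred nat) (n : nat) :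
  (0 < d)%N -> in_semigroup d ->
  (forall s, T s -> in_semigroup s) ->
  (forall s, in_semigroup s -> ~~ T (s + d)%N) ->
  (count T (iota 0 n) <= d)%N.
Proof.
move=> d_gt0 d_in T_in T_apery.
have T_lt s t : T s -> T t -> s = t %[mod d] -> (s < t)%N -> False.
  move=> Ts Tt st lt_st; have /dvdnP[k kE] : (d %| t - s)%N.
    by rewrite -eqn_mod_dvd ?st // ltnW.
  have k_gt0 : (0 < k)%N by nia.
  have mul_in j : in_semigroup (s + j * d)%N.
    elim: j => [|j IHj]; first by rewrite addn0 T_in.
    by rewrite mulSn addnCA addnC in_semigroupD.
  have := T_apery _ (mul_in k.-1).
  by rewrite -addnA -mulSnr prednK // -kE subnKC ?Tt // ltnW.
rewrite -size_filter -(size_map (fun s => s %% d)%N) -{2}(size_iota 0 d).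
apply: uniq_leq_size => [|r /mapP[s _ ->]]; last first.
  by rewrite mem_iota /= add0n ltn_pmod.
rewrite map_inj_in_uniq ?filter_uniq ?iota_uniq // => s t.
rewrite !mem_filter => /andP[Ts _] /andP[Tt _] st.
case: (ltngtP s t) => // [/(T_lt _ _ Ts Tt st) //|].
by move/(T_lt _ _ Tt Ts (esym st)).
Qed.

End Semigroup.

Local Open Scope ring_scope.

(** * Leading terms modulo the curve equation *)

Section Reduction.

Variables (K : finFieldType) (q : nat).
Hypothesis q_gt1 : (1 < q)%N.

Local Notation A := {mpoly K[2]}.
Local Notation point := {ffun 'I_2 -> K}.

Definition weight_below (n : nat) (f : A) : Prop :=
  forall u, u \in msupp f -> (weight q u < n)%N.

Lemma weight_below0 n : weight_below n 0.
Proof. by move=> u; rewrite msupp0. Qed.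

Lemma weight_below0_eq0 f : weight_below 0 f -> f = 0.
Proof.
rewrite /weight_below => hf; apply: msuppnil0.
by case: (msupp f) hf => // u r /(_ u (mem_head _ _)).
Qed.

Lemma weight_belowD n f g :
  weight_below n f -> weight_below n g -> weight_below n (f + g).
Proof.
by move=> hf hg u /msuppD_le; rewrite mem_cat => /orP[/hf|/hg].
Qed.

Lemma weight_belowZ n c f : weight_below n f -> weight_below n (c *: f).
Proof. by move=> hf u /msuppZ_le/hf. Qed.

Lemma weight_belowB n f g :
  weight_below n f -> weight_below n g -> weight_below n (f - g).
Proof.
by move=> hf hg; rewrite -scaleN1r; apply/weight_belowD/weight_belowZ.
Qed.

Lemma weight_below_leq m n f :
  (m <= n)%N -> weight_below m f -> weight_below n f.
Proof. by move=> mn hf u /hf; lia. Qed.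

Lemma weight_belowX n u : (weight q u < n)%N -> weight_below n 'X_[u].
Proof. by move=> un v; rewrite msuppX inE => /eqP->. Qed.

Lemma weightD u v : weight q (u + v)%MM = (weight q u + weight q v)%N.
Proof. by rewrite /weight !mnmDE !mulnDl addnACA. Qed.

Lemma weight_belowMX n f u :
  weight_below n f -> weight_below (n + weight q u) (f * 'X_[u]).
Proof.
move=> hf v /msuppM_le /allpairsP[[a b] /= [/hf a_lt]].
by rewrite msuppX inE => /eqP-> ->; rewrite weightD ltn_add2r.
Qed.

Lemma weight_below_exists f : exists n, weight_below n f.
Proof.
exists (\max_(u <- msupp f) weight q u).+1 => u uf.
by rewrite ltnS (leq_bigmax_seq (F := weight q)).
Qed.

(** Reduction is performed modulo the curve equation alone, so that it applies
    both to functions on [D] and to the ideal generated by the equation and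
    [F]. *)
Definition reduces_below (n : nat) (f : A) : Prop :=
  exists h, weight_below n (f - h * hermH K q).

Lemma weight_below_reduces n f : weight_below n f -> reduces_below n f.
Proof. by move=> hf; exists 0; rewrite mul0r subr0. Qed.

Lemma reduces_belowD n f g :
  reduces_below n f -> reduces_below n g -> reduces_below n (f + g).
Proof.
move=> [h hf] [k hg]; exists (h + k).
by rewrite mulrDl opprD addrACA; apply: weight_belowD.
Qed.

Lemma reduces_belowZ n c f : reduces_below n f -> reduces_below n (c *: f).
Proof.
move=> [h hf]; exists (c *: h).
by rewrite -scalerAl -scalerBr; apply: weight_belowZ.
Qed.

(** The unique monomial of weight [s] whose exponent in [y] is less than [q],
    when [s] is in the semigroup; otherwise the subtraction truncates and the
    weight is not [s]. *)
Definition normal_monomial (s : nat) : 'X_{1..2} :=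
  [multinom [tuple (s %/ q - s %% q)%N; (s %% q)%N]].

Lemma multinom2_eq (u v : 'X_{1..2}) :
  u ix = v ix -> u iy = v iy -> u = v.
Proof.
move=> hx hy; apply/mnmP => i.
case: (eqVneq i ix) => [-> //|i_ix].
by have -> : i = iy by apply/val_inj; case: i i_ix => [[|[]]].
Qed.

Lemma multinom2x a b : [multinom [tuple a; b]] ix = a.
Proof. by rewrite multinomE. Qed.

Lemma multinom2y a b : [multinom [tuple a; b]] iy = b.
Proof. by rewrite multinomE. Qed.

Lemma weight_multinom2 a b :
  weight q [multinom [tuple a; b]] = (a * q + b * q.+1)%N.
Proof. by rewrite /weight multinom2x multinom2y. Qed.

Lemma weight_normal_monomial s :
  in_semigroup q s -> weight q (normal_monomial s) = s.
Proof. by rewrite weight_multinom2 => /in_semigroupE <-. Qed.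

Lemma weight_in_semigroup (u : 'X_{1..2}) : in_semigroup q (weight q u).
Proof. exact: in_semigroup_gen. Qed.

Lemma normal_monomial_id (u : 'X_{1..2}) :
  (u iy < q)%N -> normal_monomial (weight q u) = u.
Proof.
move=> uy; rewrite /normal_monomial.
have -> : weight q u = ((u ix + u iy) * q + u iy)%N by rewrite /weight; lia.
rewrite modnMDl divnMDl ?modn_small ?divn_small ?addn0; try lia.
by apply: multinom2_eq; rewrite ?multinom2x ?multinom2y ?addnK.
Qed.

Lemma mpolyX2 (u : 'X_{1..2}) : 'X_[u] = 'X_ix ^+ u ix * 'X_iy ^+ u iy :> A.
Proof.
rewrite mpolyXE_id big_ord_recl big_ord1.
by congr (_ * 'X_ _ ^+ u _); apply/val_inj.
Qed.

Lemma curve_identity (R : comNzRingType) (xa xq yb yq y : R) :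
  xa * (yb * yq) = xa * xq * yb - xa * (yb * y) - xa * yb * (xq - yq - y).
Proof. by ring. Qed.

(** On the curve [y ^ q] is [x ^ q.+1 - y], where [x ^ q.+1] has the same
    weight as [y ^ q] and [y] has smaller weight.  Repeating this replacement
    lowers the exponent of [y] below [q]. *)
Lemma monomial_reduces (u : 'X_{1..2}) :
  reduces_below (weight q u) ('X_[u] - 'X_[normal_monomial (weight q u)]).
Proof.
have [k] := ubnP (u iy); elim: k u => // k IHk u uk.
have [uq | uq] := ltnP (u iy) q.
  rewrite normal_monomial_id // subrr.
  exact/weight_below_reduces/weight_below0.
pose a := u ix; pose b := (u iy - q)%N.
pose v := [multinom [tuple (a + q.+1)%N; b]].
pose t := [multinom [tuple a; b.+1]].
have wv : weight q v = weight q u.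
  by rewrite weight_multinom2 /weight /a /b; nia.
have wt : (weight q t < weight q u)%N.
  by rewrite weight_multinom2 /weight /a /b; nia.
have uE : 'X_[u] = 'X_[v] - 'X_[t]
                 - 'X_[[multinom [tuple a; b]]] * hermH K q :> A.
  rewrite (mpolyX2 u) (mpolyX2 v) (mpolyX2 t) (mpolyX2 [multinom _]).
  rewrite /v /t !multinom2x !multinom2y -{1}(subnK uq) -/a -/b.
  rewrite !exprD (exprSr _ b).
  exact: curve_identity.
have [|h hv] := IHk v; first by rewrite multinom2y /b; lia.
rewrite wv in hv; exists (h - 'X_[[multinom [tuple a; b]]]); rewrite uE.
have regroup (r x y z l w : A) :
  x - y - z * r - w - (l - z) * r = x - w - l * r - y by ring.
rewrite regroup.
by apply: weight_belowB => //; apply: weight_belowX.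
Qed.

Lemma leading_term_reduces n f : weight_below n.+1 f ->
  exists2 c, in_semigroup q n || (c == 0)
           & reduces_below n (f - c *: 'X_[normal_monomial n]).
Proof.
rewrite {2}[f]mpolyE /weight_below; elim: (msupp f) => [_|u r IHr ur].
  exists 0; rewrite ?eqxx ?orbT // big_nil scale0r subr0.
  exact/weight_below_reduces/weight_below0.
have [|c c_in hc] := IHr; first by move=> v vr; apply: ur; rewrite inE vr orbT.
have := ur u; rewrite inE eqxx ltnS leq_eqVlt => /(_ isT).
rewrite big_cons; case/orP => [/eqP un | un].
  exists (f@_u + c); first by rewrite -un weight_in_semigroup.
  rewrite scalerDl opprD addrACA -scalerBr; apply: reduces_belowD => //.
  by rewrite -un; apply/reduces_belowZ/monomial_reduces.
exists c => //; rewrite -addrA; apply: reduces_belowD => //.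
exact/weight_below_reduces/weight_belowZ/weight_belowX.
Qed.

End Reduction.

(** * The weight filtration on the functions on D *)

Section Filtration.

Variables (K : finFieldType) (q : nat).
Hypothesis q_gt1 : (1 < q)%N.

Local Notation A := {mpoly K[2]}.
Local Notation point := {ffun 'I_2 -> K}.

Variable D : {set point}.
Hypothesis D_curve : D \subset hermE K q.

Local Notation W := 'rV[K]_#|D|.

Definition restriction (f : A) : W := \row_(i < #|D|) f.@[(enum_val i : point)].

Lemma restrictionD f g : restriction (f + g) = restriction f + restriction g.
Proof. by apply/rowP => i; rewrite !mxE mevalD. Qed.

Lemma restrictionB f g : restriction (f - g) = restriction f - restriction g.
Proof. by apply/rowP => i; rewrite !mxE mevalB. Qed.

Lemma restrictionZ c f : restriction (c *: f) = c *: restriction f.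
Proof. by apply/rowP => i; rewrite !mxE mevalZ. Qed.

Lemma restriction0 : restriction 0 = 0.
Proof. by apply/rowP => i; rewrite !mxE meval0. Qed.

Lemma restriction_eqP f g :
  restriction f = restriction g <-> {in D, forall P : point, f.@[P] = g.@[P]}.
Proof.
split=> [/rowP fg P PD | fg].
  by have := fg (enum_rank_in PD P); rewrite !mxE enum_rankK_in.
by apply/rowP => i; rewrite !mxE fg ?enum_valP.
Qed.

Lemma restriction_eq0P f : restriction f = 0 <-> vanishing_ideal D f.
Proof.
rewrite -restriction0; split=> [/restriction_eqP f0 P PD | f0].
  by rewrite f0 ?meval0.
by apply/restriction_eqP => P PD; rewrite f0 ?meval0.
Qed.

Lemma hermH_vanishing : vanishing_ideal D (hermH K q).
Proof. by move=> P /(subsetP D_curve); rewrite inE => /eqP. Qed.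

Lemma restriction_mulH h : restriction (h * hermH K q) = 0.
Proof.
by apply/restriction_eq0P => P PD; rewrite mevalM hermH_vanishing ?mulr0.
Qed.

Definition step_vector (n : nat) : W :=
  if in_semigroup q n then restriction 'X_[normal_monomial q n] else 0.

(** The restrictions to [D] of the polynomials of weight less than [n], built
    one weight at a time so that dimensions can be counted; see
    [mem_filtrationP]. *)
Fixpoint filtration (n : nat) : {vspace W} :=
  if n is n'.+1 then (filtration n' + <[step_vector n']>)%VS else 0%VS.

Definition is_jump (n : nat) : bool := step_vector n \notin filtration n.

Lemma mem_filtrationP n v :
  v \in filtration n <-> exists2 f, weight_below q n f & v = restriction f.
Proof.
split.
  elim: n v => [|n IHn] v /=.
    rewrite memv0 => /eqP->; exists 0; rewrite ?restriction0 //.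
    exact: weight_below0.
  case/memv_addP => _ /IHn[f hf ->] [_ /vlineP[c ->] ->].
  rewrite /step_vector; case: ifP => [n_in | _].
    exists (f + c *: 'X_[normal_monomial q n]); last first.
      by rewrite restrictionD restrictionZ.
    apply: weight_belowD; first exact: weight_below_leq hf.
    by apply/weight_belowZ/weight_belowX; rewrite weight_normal_monomial.
  by exists f; rewrite ?scaler0 ?addr0 //; apply: weight_below_leq hf.
case=> f; elim: n f v => [|n IHn] f v hf ->.
  by rewrite (weight_below0_eq0 hf) restriction0 mem0v.
have [c c_in [h hh]] := leading_term_reduces q_gt1 hf.
have -> : restriction f = restriction (f - c *: 'X_[normal_monomial q n]
                                       - h * hermH K q)
                          + c *: step_vector n.
  rewrite !restrictionB restriction_mulH subr0 restrictionZ /step_vector.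
  by case: ifP c_in => [_ _ | _ /eqP->]; rewrite ?scale0r ?subr0 ?addr0 ?subrK.
by rewrite /= memv_add ?(IHn _ _ hh) //; apply/memvZ/memv_line.
Qed.

Lemma dim_filtration n : \dim (filtration n) = count is_jump (iota 0 n).
Proof.
elim: n => [|n IHn]; first by rewrite dimv0.
have -> : iota 0 n.+1 = iota 0 n ++ [:: n] by rewrite -addn1 iotaD.
rewrite count_cat -IHn /= addn0 /is_jump.
have [b_in | b_notin] := boolP (step_vector n \in filtration n).
  by rewrite addn0 (addv_idPl _) // -memvE.
rewrite dimv_disjoint_sum ?dim_vline.
  by case: eqP b_notin => // ->; rewrite mem0v.
apply/eqP; rewrite -subv0; apply/subvP => w; rewrite memv_cap => /andP[wL].
case/vlineP => c wE; have [c0 | c0] := eqVneq c 0.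
  by rewrite wE c0 scale0r mem0v.
case/negP: b_notin; have -> : step_vector n = c^-1 *: w.
  by rewrite wE scalerA mulVf ?scale1r.
exact: memvZ.
Qed.

Lemma dim_words : \dim {:W} = #|D|.
Proof. by rewrite dimvf; apply: mul1n. Qed.

Lemma count_jumps_leq n : (count is_jump (iota 0 n) <= #|D|)%N.
Proof.
by rewrite -dim_filtration (leq_trans (dimvS (subvf _))) // dim_words.
Qed.

Lemma count_jumps_full n :
  filtration n = fullv -> count is_jump (iota 0 n) = #|D|.
Proof. by rewrite -dim_filtration => ->; apply: dim_words. Qed.

Lemma jump_in_semigroup n : is_jump n -> in_semigroup q n.
Proof.
apply: contraTT => /negbTE n_in.
by rewrite /is_jump /step_vector n_in mem0v.
Qed.

Lemma not_jumpP s : in_semigroup q s -> ~~ is_jump s ->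
  exists2 g, weight_below q s g
           & restriction 'X_[normal_monomial q s] = restriction g.
Proof.
by move=> s_in; rewrite negbK /step_vector s_in => /mem_filtrationP.
Qed.

(** All monomials of the same weight agree on the curve up to lower weight, so a
    weight may be tested for being a jump on any of them. *)
Lemma not_jump_of_monomial (u : 'X_{1..2}) n (g : A) :
  weight_below q n g -> weight q u = n ->
  restriction 'X_[u] = restriction g -> ~~ is_jump n.
Proof.
move=> hg un ug; rewrite negbK /step_vector -un weight_in_semigroup //.
have [h hh] := monomial_reduces K q_gt1 u.
apply/mem_filtrationP.
exists (g - ('X_[u] - 'X_[normal_monomial q (weight q u)] - h * hermH K q)).
  by apply: weight_belowB => //; rewrite un.
by rewrite !restrictionB restriction_mulH subr0 ug subKr.
Qed.

(** If [s] is not a jump, the monomial of weight [s] agrees on [D] with a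
    polynomial of smaller weight; multiplying by a monomial of weight [t]
    gives the same for [s + t]. *)
Lemma jump_divisor s t :
  in_semigroup q s -> in_semigroup q t -> is_jump (s + t) -> is_jump s.
Proof.
move=> s_in t_in; apply: contraTT.
move=> /(not_jumpP s_in)[g hg /restriction_eqP sg].
have wt := weight_normal_monomial q_gt1 t_in.
apply: (@not_jump_of_monomial (normal_monomial q s + normal_monomial q t) _
          (g * 'X_[normal_monomial q t])).
- by rewrite -{1}wt; apply: weight_belowMX.
- by rewrite weightD wt weight_normal_monomial.
- by apply/restriction_eqP => P PD; rewrite mpolyXD !mevalM sg.
Qed.

End Filtration.

(** * Counting jumps *)

Section Interpolation.

Variable K : finFieldType.
Local Notation A := {mpoly K[2]}.
Local Notation point := {ffun 'I_2 -> K}.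

(** [z ^+ #|K|.-1] is [1] for every nonzero [z] in [K]. *)
Definition point_indicator (P : point) : A :=
  \prod_(i < 2) (1 - ('X_i - (P i)%:MP) ^+ #|K|.-1).

Lemma point_indicatorE (P Q : point) : (point_indicator P).@[Q] = (Q == P)%:R.
Proof.
have K_gt1 := finNzRing_gt1 K.
rewrite /point_indicator rmorph_prod /=.
under eq_bigr do rewrite rmorphB rmorph1 rmorphXn /= mevalB mevalXU mevalC.
have [-> | QP] := eqVneq Q P.
  rewrite big1 // => i _; rewrite subrr expr0n.
  by case: #|K| K_gt1 => [|[|n]] // _; rewrite subr0.
have [i Qi] : exists i, Q i != P i.
  apply/existsP; rewrite -negb_forall; apply: contraNN QP => /forallP QP.
  by apply/eqP/ffunP => i; apply/eqP/QP.
rewrite (bigD1 i) //=; set z := Q i - P i.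
have z0 : z != 0 by rewrite subr_eq0.
have -> : z ^+ #|K|.-1 = 1.
  by apply: (mulIf z0); rewrite -exprSr prednK ?expf_card ?mul1r // ltnW.
by rewrite subrr mul0r.
Qed.

End Interpolation.

Section Bound.

Variables (K : finFieldType) (q : nat).
Hypothesis q_gt1 : (1 < q)%N.

Local Notation A := {mpoly K[2]}.
Local Notation point := {ffun 'I_2 -> K}.

Variable D : {set point}.
Hypothesis D_curve : D \subset hermE K q.

Local Notation filtration := (filtration q D).
Local Notation is_jump := (is_jump q D).

Lemma restriction_interpolation (v : 'rV[K]_#|D|) :
  v = restriction D (\sum_i v 0 i *: point_indicator (enum_val i)).
Proof.
apply/rowP => j; rewrite mxE raddf_sum (bigD1 j) //= big1 => [|i ij].
  by rewrite mevalZ point_indicatorE eqxx mulr1 addr0.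
rewrite mevalZ point_indicatorE (inj_eq enum_val_inj) eq_sym (negbTE ij).
by rewrite mulr0.
Qed.

Lemma filtration_full_exists : exists n, filtration n = fullv.
Proof.
have [N hN] := fin_all_exists
  (fun P : point => weight_below_exists q (point_indicator P)).
have [M hM] : exists M, forall P, (N P <= M)%N.
  by exists (\max_P N P) => P; apply: (leq_bigmax (F := N)).
exists M; apply/eqP; rewrite eqEsubv subvf; apply/subvP => v _.
rewrite [v]restriction_interpolation.
apply/(mem_filtrationP q_gt1 D_curve); eexists; last by [].
elim/big_ind: _ => [||i _]; first exact: weight_below0.
  exact: weight_belowD.
by apply: weight_belowZ; have := hN (enum_val i); apply: weight_below_leq.
Qed.

Lemma filtrationS_not_jump n : ~~ is_jump n -> filtration n.+1 = filtration n.
Proof. by rewrite negbK memvE => /addv_idPl. Qed.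

Lemma filtration_full_leq m n :
  (m <= n)%N -> filtration m = fullv -> filtration n = fullv.
Proof.
elim: n => [|n IHn]; first by rewrite leqn0 => /eqP->.
rewrite leq_eqVlt => /orP[/eqP-> // | mn /(IHn mn) full_n].
by rewrite filtrationS_not_jump // negbK full_n memvf.
Qed.

(** Past some weight the filtration is full, so a deficit at [n] has to be made
    up by a jump at or after [n]. *)
Lemma large_jump n : filtration n != fullv -> exists2 s, (n <= s)%N & is_jump s.
Proof.
have [N full] := filtration_full_exists.
have : filtration (N + n) = fullv.
  by apply: filtration_full_leq full; rewrite leq_addr.
elim: N n {full} => [|N IHN] n full n_full.
  by rewrite full eqxx in n_full.
have [jump | no_jump] := boolP (is_jump n); first by exists n.
have [||s ns jump] := IHN n.+1; first by rewrite addnS -addSn.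
  by rewrite filtrationS_not_jump.
by exists s => //; apply: ltnW.
Qed.

Lemma jump_decomposition n s : is_jump n -> (s <= n)%N ->
  in_semigroup q s -> in_semigroup q (n - s) -> is_jump s.
Proof.
by move=> jump sn s_in ns_in; apply: jump_divisor s_in ns_in _; rewrite ?subnKC.
Qed.

Lemma leq_count_in (T : eqType) (a b : pred T) (r : seq T) :
  {in r, subpred a b} -> (count a r <= count b r)%N.
Proof.
move=> ab; rewrite -(@eq_in_count _ (predI a b)) => [|x xr /=].
  by apply: sub_count => x /andP[].
by apply/andP/idP => [[]//|ax]; split=> //; apply: ab.
Qed.

(** The Feng-Rao argument: a jump [s >= n] makes every [t] with [t] and [s - t]
    in the semigroup a jump, and there are at least [s.+1 - (q * q - q)] of
    them. *)
Lemma designed_distance n :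
  filtration n != fullv -> (n.+1 <= #|D| + (q * q - q))%N.
Proof.
case/large_jump => s ns jump; have := count_jumps_leq q D s.+1.
have := count_decompositions q_gt1 s; set c := count _ _.
suff : (c <= count is_jump (iota 0 s.+1))%N by lia.
apply: leq_count_in => t; rewrite mem_iota /= add0n ltnS => ts /andP[].
exact: jump_decomposition.
Qed.

(** When the designed distance is attained, the jumps are exactly the [t] with
    [t] and [n - t] in the semigroup.  This excludes [#|D|], whose complement
    [q * q - q - 1] is the largest gap. *)
Lemma card_not_jump n : filtration n != fullv ->
  (#|D| + (q * q - q) = n.+1)%N -> ~~ is_jump #|D|.
Proof.
case/large_jump => s ns jump cardD; apply/negP => jumpD.
have := count_jumps_leq q D s.+1.
have := count_decompositions q_gt1 s; set P := (fun t => _); set c := count _ _.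
suff : (c + (n == s) <= count is_jump (iota 0 s.+1))%N by case: eqP; lia.
have D_le : (#|D| <= s)%N by nia.
have [ns_eq | _] := eqVneq n s; last first.
  rewrite addn0; apply: leq_count_in => t; rewrite mem_iota /= add0n ltnS => ts.
  by case/andP; apply: jump_decomposition.
have not_PD : ~~ P #|D|.
  rewrite /P; have -> : (s - #|D| = q * q - q - 1)%N by lia.
  by rewrite largest_gap // andbF.
have D_once : count (pred1 #|D|) (iota 0 s.+1) = 1%N.
  by rewrite count_uniq_mem ?iota_uniq // mem_iota /= add0n ltnS D_le.
have := count_predUI P (pred1 #|D|) (iota 0 s.+1).
rewrite (@eq_count _ (predI _ _) pred0) => [|t /=]; last first.
  by apply/negP => /andP[Pt /eqP tD]; rewrite -tD Pt in not_PD.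
rewrite count_pred0 addn0 D_once -/c => <-.
apply: leq_count_in => t; rewrite mem_iota /= add0n ltnS => ts.
by case/orP=> [/andP[] | /eqP->] //; apply: jump_decomposition.
Qed.

(** If [#|D|] is not a jump, the jumps lie in the Apery set of [#|D|], which has
    at most [#|D|] elements; as there are [#|D|] jumps, they fill it. *)
Lemma jump_apery s : (0 < #|D|)%N -> in_semigroup q #|D| -> ~~ is_jump #|D| ->
  in_semigroup q s -> (forall t, in_semigroup q t -> s != (t + #|D|)%N) ->
  is_jump s.
Proof.
move=> D_gt0 D_in D_jump s_in s_apery; apply: contraT => s_jump.
have [N full] := filtration_full_exists.
have {}full := filtration_full_leq (leq_addr s.+1 N) full.
have T_in t : predU1 s is_jump t -> in_semigroup q t.
  by case/orP => [/eqP-> // | /jump_in_semigroup].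
have T_apery t : in_semigroup q t -> ~~ predU1 s is_jump (t + #|D|)%N.
  move=> t_in /=; rewrite negb_or eq_sym s_apery //=.
  apply: contraNN D_jump; rewrite addnC; exact: jump_divisor.
have := count_apery q_gt1 (N + s.+1) D_gt0 D_in T_in T_apery.
have := count_predUI (pred1 s) is_jump (iota 0 (N + s.+1)).
rewrite (@eq_count _ (predI _ _) pred0) => [|t /=]; last first.
  by apply: contraNF s_jump => /andP[/eqP->].
rewrite count_pred0 addn0 (count_jumps_full full) => ->.
rewrite count_uniq_mem ?iota_uniq // mem_iota /= add0n addnS ltnS leq_addl.
by rewrite add1n ltnn.
Qed.

End Bound.

(** * The vanishing ideal of D *)

Section Ideals.

Variables (K : finFieldType) (q : nat).
Hypothesis q_gt1 : (1 < q)%N.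

Local Notation A := {mpoly K[2]}.
Local Notation point := {ffun 'I_2 -> K}.

Variable D : {set point}.
Hypothesis D_curve : D \subset hermE K q.

Local Notation is_jump := (is_jump q D).

Lemma ideal_gen2P (R : comNzRingType) (a b f : R) :
  ideal_gen [:: a; b] f <-> exists x y, f = x * a + y * b.
Proof.
split=> [[c ->] | [x [y ->]]].
  by exists (c 0%N), (c 1%N); rewrite big_ord_recl big_ord1.
by exists (fun i => if i is 0%N then x else y); rewrite big_ord_recl big_ord1.
Qed.

(** This lemma and the next identify the weights in the semigroup that are not
    jumps with the leading weights of polynomials vanishing on [D]. *)
Lemma leading_term_not_jump (F : A) (u : 'X_{1..2}) c :
  c != 0 -> vanishing_ideal D F ->
  weight_below q (weight q u) (F - c *: 'X_[u]) -> ~~ is_jump (weight q u).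
Proof.
move=> c0 /restriction_eq0P F0 hF.
pose g := - c^-1 *: (F - c *: 'X_[u]).
apply: (@not_jump_of_monomial _ _ q_gt1 D D_curve u _ g) => //.
  exact: weight_belowZ.
rewrite restrictionZ restrictionB F0 sub0r restrictionZ.
by rewrite scalerN scaleNr opprK scalerA mulVf ?scale1r.
Qed.

Lemma not_jump_leading_term (u : 'X_{1..2}) :
  (u iy < q)%N -> ~~ is_jump (weight q u) ->
  exists2 F : A, vanishing_ideal D F & weight_below q (weight q u) (F - 'X_[u]).
Proof.
move=> uy /(not_jumpP q_gt1 D_curve (weight_in_semigroup q_gt1 u)).
rewrite normal_monomial_id // => -[g hg ug]; exists ('X_[u] - g).
  by apply/restriction_eq0P; rewrite restrictionB ug subrr.
by rewrite addrAC subrr add0r -scaleN1r; apply: weight_belowZ.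
Qed.

(** The leading weight of a polynomial vanishing on [D] is not a jump, so it
    lies in [#|D| + semigroup] and a multiple of [F] cancels the leading term;
    the claim follows by induction on the weight. *)
Lemma vanishing_in_ideal (F : A) (u : 'X_{1..2}) :
  (0 < #|D|)%N -> weight q u = #|D| -> vanishing_ideal D F ->
  weight_below q #|D| (F - 'X_[u]) ->
  forall f, vanishing_ideal D f -> ideal_gen [:: hermH K q; F] f.
Proof.
move=> D_gt0 uD F0 hF.
have D_in : in_semigroup q #|D| by rewrite -uD weight_in_semigroup.
have D_jump : ~~ is_jump #|D|.
  by rewrite -uD (@leading_term_not_jump F u 1) ?oner_eq0 // scale1r uD.
have ideal_shift (f x y : A) :
    ideal_gen [:: hermH K q; F] (f - x * F - y * hermH K q) ->
    ideal_gen [:: hermH K q; F] f.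
  move=> /ideal_gen2P[a [b fE]]; apply/ideal_gen2P; exists (a + y), (b + x).
  by rewrite !mulrDl addrACA -fE; ring.
have vanishing_shift (f x y : A) :
    vanishing_ideal D f -> vanishing_ideal D (f - x * F - y * hermH K q).
  move=> f0 P PD; rewrite !mevalB !mevalM f0 // F0 //.
  by rewrite (hermH_vanishing D_curve) // !mulr0 !subr0.
move=> f f0; have [n hf] := weight_below_exists q f.
elim: n f f0 hf => [|n IHn] f f0 hf.
  rewrite (weight_below0_eq0 hf).
  by apply/ideal_gen2P; exists 0, 0; rewrite !mul0r addr0.
have [c c_in hc] := leading_term_reduces q_gt1 hf.
suff [x [y hxy]] : exists x, reduces_below q n (f - x * F).
  by apply: (ideal_shift f x y); apply: IHn hxy; apply: vanishing_shift.
have [c0 | c0] := eqVneq c 0.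
  by exists 0; rewrite mul0r subr0; rewrite c0 scale0r subr0 in hc.
rewrite (negbTE c0) orbF in c_in.
have n_jump : ~~ is_jump n.
  case: hc => h; rewrite -{1}(weight_normal_monomial q_gt1 c_in) => hc.
  rewrite -(weight_normal_monomial q_gt1 c_in).
  apply: (@leading_term_not_jump (f - 0 * F - h * hermH K q) _ c) => //.
    exact: vanishing_shift.
  by rewrite mul0r subr0 addrAC.
have /andP[n_ge t_in] : (#|D| <= n)%N && in_semigroup q (n - #|D|).
  apply: contraR n_jump => no_t; apply: jump_apery => // t t_in.
  by apply: contraNneq no_t => ->; rewrite leq_addl addnK.
set t := normal_monomial q (n - #|D|).
have tn : weight q (u + t) = n.
  by rewrite weightD weight_normal_monomial // uD subnKC.
exists (c *: 'X_[t]).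
(* [X_u * X_t] and the normal monomial of weight [n] may differ, but only by
   lower weight modulo the curve equation. *)
have -> : f - c *: 'X_[t] * F = (f - c *: 'X_[normal_monomial q n])
  + - c *: ('X_[u + t] - 'X_[normal_monomial q n])
  + - c *: ((F - 'X_[u]) * 'X_[t]).
  rewrite mpolyXD -!mul_mpolyC rmorphN /=; ring.
apply: reduces_belowD; first apply: reduces_belowD => //.
  by apply: reduces_belowZ; rewrite -{1 2}tn; apply: monomial_reduces.
apply/reduces_belowZ/weight_below_reduces.
by rewrite -tn weightD uD; apply: weight_belowMX.
Qed.

End Ideals.

(** * Codewords and the filtration *)

Section Code.

Variables (K : finFieldType) (q : nat).
Hypothesis cardK : #|K| = (q ^ 2)%N.

Local Notation A := {mpoly K[2]}.
Local Notation point := {ffun 'I_2 -> K}.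
Local Notation E := (hermE K q).

Lemma ideal_E_vanishing (f : A) : ideal_E q f -> vanishing_ideal E f.
Proof.
move=> [c ->] P PE; rewrite raddf_sum big1 // => i _ /=; rewrite mevalM.
have field_eq j : ('X_j ^+ (q ^ 2) - 'X_j : A).@[P] = 0.
  by rewrite mevalB rmorphXn /= mevalXU -cardK expf_card subrr.
case: i => [[|[|[|//]]] //= _]; rewrite ?field_eq ?mulr0 //.
by move: PE; rewrite inE => /eqP->; rewrite mulr0.
Qed.

(** The field equations vanish at every point over [K], so evaluation factors
    through the quotient by [ideal_E] and only genuine polynomials of bounded
    weight need to be tested. *)
Lemma hermitian_codeP (n : nat) (c : word K q) :
  hermitian_code n%:Z c <->
  forall g : A, weight_below q n.+1 g -> \sum_i c 0 i * g.@[pt i] = 0.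
Proof.
split=> [cC g hg | c_kills _ [f [g hg /ideal_E_vanishing fg] ->]].
  have -> : \sum_i c 0 i * g.@[pt i] = \sum_i c 0 i * eval_word q g 0 i.
    by apply: eq_bigr => i _; rewrite mxE.
  apply: cC; exists g => //; exists g; first by move=> u /hg; rewrite lez_nat.
  by exists (fun=> 0); rewrite subrr big1 // => i _; rewrite mul0r.
have g_sum : \sum_i c 0 i * g.@[pt i] = 0.
  by apply: c_kills => u /hg; rewrite lez_nat.
rewrite -[RHS]g_sum; apply: eq_bigr => i _; rewrite mxE; congr (_ * _).
apply/eqP; by rewrite -subr_eq0 -mevalB fg // /pt enum_valP.
Qed.

Lemma mem_supp (c : word K q) i : (pt i \in supp c) = (c 0 i != 0).
Proof. by rewrite /supp mem_imset ?inE //; apply: enum_val_inj. Qed.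

Lemma card_supp (c : word K q) : #|supp c| = hweight c.
Proof.
rewrite /supp card_imset; last exact: enum_val_inj.
by rewrite /hweight; apply: eq_card => i; rewrite inE.
Qed.

Lemma supp_curve (c : word K q) : supp c \subset E.
Proof. by apply/subsetP => P /imsetP[i _ ->]; apply: enum_valP. Qed.

Hypothesis q_gt1 : (1 < q)%N.

(** If the polynomials of weight at most [n] gave every function on the support,
    one of them would be the indicator of a single point there, and the relation
    [c] applied to it would force the coefficient at that point to vanish. *)
Lemma supp_filtration (n : nat) (c : word K q) :
  hermitian_code n%:Z c -> c != 0 -> filtration q (supp c) n.+1 != fullv.
Proof.
move=> /hermitian_codeP c_kills; apply: contraNneq => full.
apply/eqP/rowP => i; rewrite mxE.
have : restriction (supp c) (point_indicator (pt i))
         \in filtration q (supp c) n.+1 by rewrite full memvf.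
case/(mem_filtrationP q_gt1 (supp_curve c)) => g /c_kills g_sum.
move/restriction_eqP => gi.
rewrite -[RHS]g_sum (bigD1 i) //= big1 => [|j ji].
  have [/eqP-> | ci] := boolP (c 0 i == 0); first by rewrite mul0r addr0.
  by rewrite -gi ?mem_supp // point_indicatorE eqxx mulr1 addr0.
have [/eqP-> | cj] := boolP (c 0 j == 0); first by rewrite mul0r.
rewrite -gi ?mem_supp // point_indicatorE (inj_eq enum_val_inj) (negbTE ji).
by rewrite mulr0.
Qed.

(** Some nonzero functional on the functions on [D] vanishes on the proper
    subspace; its values at the indicators of the points of [D] form [c]. *)
Lemma word_of_filtration (n : nat) (D : {set point}) :
  D \subset E -> filtration q D n.+1 != fullv ->
  exists c : word K q, [/\ hermitian_code n%:Z c, c != 0 & supp c \subset D].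
Proof.
move=> D_curve L_proper; set L := filtration q D n.+1 in L_proper *.
have [v v_notin] : exists v, v \notin L.
  apply/existsP; rewrite -negb_forall.
  apply: contraNN L_proper => /forallP L_all.
  by rewrite eqEsubv subvf; apply/subvP => v _; have := L_all v.
(* A coordinate of the projection to a complement of [L] is such a
   functional. *)
pose phi := (\1 - projv L)%VF.
have phiE w : phi w = w - projv L w by rewrite add_lfunE opp_lfunE id_lfunE.
have [j vj] : exists j, phi v 0 j != 0.
  apply/existsP; rewrite -negb_forall; apply: contraNN v_notin => /forallP phi0.
  suff -> : v = projv L v by apply: memv_proj.
  apply/eqP; rewrite -subr_eq0 -phiE; apply/eqP/rowP => j; rewrite mxE.
  exact/eqP.
pose r i := restriction D (point_indicator (@pt K q i)).
pose c : word K q := \row_i (if pt i \in D then phi (r i) 0 j else 0).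
have phi_sum (g : A) : phi (restriction D g) 0 j = \sum_i c 0 i * g.@[pt i].
  have -> : restriction D g = \sum_(i | @pt K q i \in D) g.@[pt i] *: r i.
    apply/rowP => k; rewrite summxE mxE.
    have kE := subsetP D_curve _ (enum_valP k).
    have kpt : pt (enum_rank_in kE (enum_val k)) = enum_val k :> point.
      by rewrite /pt enum_rankK_in.
    rewrite (bigD1 (enum_rank_in kE (enum_val k))) ?kpt ?enum_valP //= big1.
      by rewrite !mxE kpt point_indicatorE eqxx mulr1 addr0.
    move=> i /andP[_ ik]; rewrite !mxE point_indicatorE -kpt.
    by rewrite (inj_eq enum_val_inj) eq_sym (negbTE ik) mulr0.
  rewrite linear_sum summxE big_mkcond /=; apply: eq_bigr => i _.
  by rewrite !mxE; case: ifP => _; rewrite ?mul0r // linearZ mxE mulrC.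
exists c; split.
- apply/hermitian_codeP => g hg; rewrite -phi_sum phiE projv_id ?subrr ?mxE //.
  by apply/(mem_filtrationP q_gt1 D_curve); exists g.
- apply: contraNneq vj => c0; rewrite (restriction_interpolation v) phi_sum c0.
  by rewrite big1 // => i _; rewrite mxE mul0r.
- apply/subsetP => P /imsetP[i]; rewrite inE => ci ->.
  by move: ci; rewrite mxE; case: ifP => //; rewrite eqxx.
Qed.

End Code.

(** * The degree order and the weight *)

(** In degree at most [q], comparing by degree and then by the exponent of [y]
    is comparing weights, because [weight u = degree * q + exponent of y]. *)
Lemma prec_weight (q : nat) (u v : 'X_{1..2}) :
  (u ix + u iy <= q)%N -> prec v u -> (weight q v < weight q u)%N.
Proof. by rewrite /prec /weight => uq /orP[|/andP[/eqP]]; nia. Qed.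

Lemma weight_prec (q : nat) (u v : 'X_{1..2}) :
  (u ix + u iy <= q)%N -> (weight q v < weight q u)%N -> prec v u.
Proof. by rewrite /prec /weight => uq; nia. Qed.

Lemma is_LM_of_weight (K : finFieldType) (q : nat) (F : {mpoly K[2]})
    (u : 'X_{1..2}) :
  (u ix + u iy <= q)%N -> weight_below q (weight q u) (F - 'X_[u]) -> is_LM F u.
Proof.
move=> uq hF; split=> [|v vF vu].
  rewrite mcoeff_msupp; apply/eqP => Fu; have := hF u.
  rewrite mcoeff_msupp mcoeffB Fu mcoeffX eqxx sub0r oppr_eq0 oner_eq0 ltnn.
  by move=> /(_ isT).
apply: weight_prec uq (hF v _).
rewrite mcoeff_msupp mcoeffB mcoeffX (eq_sym u) (negbTE vu) subr0.
by rewrite -mcoeff_msupp.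
Qed.

Lemma weight_of_is_LM (K : finFieldType) (q : nat) (F : {mpoly K[2]})
    (u : 'X_{1..2}) :
  (u ix + u iy <= q)%N -> is_LM F u ->
  weight_below q (weight q u) (F - F@_u *: 'X_[u]).
Proof.
move=> uq [_ lead] v; rewrite mcoeff_msupp mcoeffB mcoeffZ mcoeffX.
have [-> | uv] := eqVneq u v; first by rewrite mulr1 subrr eqxx.
rewrite mulr0 subr0 -mcoeff_msupp => vF; apply: prec_weight uq (lead v vF _).
by rewrite eq_sym.
Qed.

(** * Supports of minimum-weight words *)

Theorem theorem5p2 (p e q : nat) (K : finFieldType) (m : int) (mu lambda : nat)
    (D : {set {ffun 'I_2 -> K}}) :
  prime p -> (0 < e)%N -> q = (p ^ e)%N -> #|K| = (q ^ 2)%N ->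
  q%:Z ^+ 2 - q%:Z - 1 <= m ->
  m <= 2 * q%:Z ^+ 2 - 2 * q%:Z - 3 ->
  is_tilde q m m ->
  D \subset hermE K q ->
  #|D|%:Z = delta q m ->
  delta q m = (mu * q + lambda * q.+1)%N%:Z ->
  (mu <= q)%N ->
  min_supports q m D <->
  exists F : {mpoly K[2]},
    is_LM F [multinom [tuple mu; lambda]] /\ scheme_intersection q D F.
Proof.
move=> p_prime e_gt0 q_pow cardK m_ge m_le _ D_curve cardD delta_eq _.
have q_gt1 : (1 < q)%N by rewrite q_pow -(expn0 p) ltn_exp2l ?prime_gt1.
have [n m_n] : exists n : nat, m = n%:Z by exists `|m|%N; nia.
have D_weight : #|D| = (mu * q + lambda * q.+1)%N.
  by apply/eqP; rewrite -eqz_nat cardD delta_eq.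
have D_n : (#|D| + (q * q - q) = n.+2)%N.
  by move: cardD; rewrite /delta m_n; nia.
have D_gt0 : (0 < #|D|)%N by move: cardD; rewrite /delta; lia.
have D_small : (#|D| < q * q)%N by move: cardD; rewrite /delta; nia.
have degree_lt : (mu + lambda < q)%N by nia.
rewrite {cardD delta_eq m_ge m_le}m_n.
set u := [multinom [tuple mu; lambda]].
have ux : u ix = mu by apply: multinom2x.
have uy : u iy = lambda by apply: multinom2y.
have u_deg : (u ix + u iy <= q)%N by rewrite ux uy ltnW.
have uD : weight q u = #|D| by rewrite weight_multinom2.
split=> [[c [cC c0 _] DE] | [F [F_lead F_ideal]]].
  have L_proper : filtration q D n.+1 != fullv.
    by rewrite DE; apply: supp_filtration.
  have D_jump := card_not_jump q_gt1 D_curve L_proper D_n.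
  have [||F F0 hF] := @not_jump_leading_term K q q_gt1 D D_curve u.
  - by rewrite uy; lia.
  - by rewrite uD.
  exists F; split; first exact: is_LM_of_weight hF.
  move=> f; split.
    by apply: (vanishing_in_ideal q_gt1 D_curve D_gt0 uD F0); rewrite -uD.
  move=> /ideal_gen2P[a [b ->]] P PD.
  by rewrite mevalD !mevalM (hermH_vanishing D_curve) // F0 // !mulr0 addr0.
have F0 : vanishing_ideal D F.
  by apply/F_ideal/ideal_gen2P; exists 0, 1; rewrite mul0r add0r mul1r.
have D_jump : ~~ is_jump q D #|D|.
  rewrite -uD.
  apply: leading_term_not_jump F0 (weight_of_is_LM u_deg F_lead) => //.
  by rewrite -mcoeff_msupp; case: F_lead.
have L_proper : filtration q D n.+1 != fullv.
  suff : is_jump q D n.+1.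
    by apply: contraTneq => full; rewrite negbK full memvf.
  have D_in : in_semigroup q #|D| by rewrite -uD weight_in_semigroup.
  apply: jump_apery => //; first by apply: in_semigroup_large => //; lia.
  move=> t t_in; apply: contraTneq t_in => n_t.
  by have -> : (t = q * q - q - 1)%N; [lia | rewrite largest_gap].
have bound (c' : word K q) :
    hermitian_code n%:Z c' -> c' != 0 -> (#|D| <= hweight c')%N.
  move=> cC c0; have := supp_filtration cardK q_gt1 cC c0.
  move/(designed_distance q_gt1 (supp_curve c')); rewrite card_supp; lia.
have [c [cC c0 cD]] := word_of_filtration cardK q_gt1 D_curve L_proper.
have DE : D = supp c.
  by apply/esym/eqP; rewrite eqEcard cD card_supp bound.
exists c => //; split=> // c' c'C c'0.
by rewrite -card_supp -DE bound.
Qed.
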